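(* Let $\varepsilon_0(n)>0$ with $a_n:=e^{\varepsilon_0(n)}/n\to\infty$, and put $\delta_n:=1/(1+e^{\varepsilon_0(n)})$. Let $P_n:=\mathrm{Bin}(n,\delta_n)$ and let $Q_n$ be the law of the sum of two independent random variables distributed as $\mathrm{Bin}(n-1,\delta_n)$ and $\mathrm{Bern}(1-\delta_n)$. Then $$\mathrm{TV}(P_n,Q_n)\to1.$$ In particular, for every fixed $\varepsilon\ge0$, $\delta_{\mathrm{two}}(\varepsilon)\to1$, and the likelihood ratio $L_n:=dQ_n/dP_n$ satisfies $L_n\to0$ in $P_n$-probability while $L_n\to\infty$ in $Q_n$-probability.
   Context: $\mathrm{TV}(\mu,\nu):=\sup_A|\mu(A)-\nu(A)|$. For probability measures $P,Q$, $\delta_{Q\|P}(\varepsilon):=\sup_A\{Q(A)-e^{\varepsilon}P(A)\}$, and for each $n$, $\delta_{\mathrm{two}}(\varepsilon):=\max\{\delta_{Q_n\|P_n}(\varepsilon),\delta_{P_n\|Q_n}(\varepsilon)\}$. $P_n$ and $Q_n$ are the laws of the number $K_n$ of output ones in shuffled binary randomized response with flip probability $\delta_n$ on the all-zeros dataset and on the dataset with exactly one one, respectively (these are equivalent to the neighboring transcript laws); $L_n$ is evaluated at $K_n$. *)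

(* Defs.v *)
From HB Require Import structures.
From mathcomp Require Import all_boot all_order all_algebra.
From mathcomp Require Import all_classical all_reals all_analysis.

Set Implicit Arguments.
Unset Strict Implicit.
Unset Printing Implicit Defensive.

Import Order.TTheory GRing.Theory Num.Theory.
Import numFieldNormedType.Exports.

Local Open Scope classical_set_scope.
Local Open Scope ring_scope.
Local Open Scope ereal_scope.
Local Open Scope charge_scope.

Definition tv_dist d (T : measurableType d) (R : realType)
    (mu nu : probability T R) : \bar R :=
  ereal_sup [set `|mu A - nu A| | A in measurable].

(* The privacy profile delta_{Q || P}(eps); note the order of the arguments. *)
Definition privacy_profile d (T : measurableType d) (R : realType)
    (Q P : probability T R) (eps : R) : \bar R :=
  ereal_sup [set Q A - (expR eps)%:E * P A | A in measurable].

Definition delta_two d (T : measurableType d) (R : realType)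
    (P Q : probability T R) (eps : R) : \bar R :=
  maxe (privacy_profile Q P eps) (privacy_profile P Q eps).

(* Convergence in probability of X_n to l, where X_n is considered under its
   own probability P_n. The X_n are meant to be measurable. *)
Definition cvg_in_prob d (T : measurableType d) (R : realType)
    (P : nat -> probability T R) (X : nat -> T -> \bar R) (l : R) : Prop :=
  forall eta : R, (0 < eta)%R ->
    P n [set x | eta%:E < `|X n x - l%:E|] @[n --> \oo] --> 0.

Definition cvgy_in_prob d (T : measurableType d) (R : realType)
    (P : nat -> probability T R) (X : nat -> T -> \bar R) : Prop :=
  forall M : R, P n [set x | M%:E < X n x] @[n --> \oo] --> 1.

Definition flip_prob (R : realType) (eps0 : R) : R := (1 + expR eps0)^-1%R.

(* A Bernoulli variable has values in bool, with true read as 1. *)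
Definition add_nat_bool (x : nat * bool) : nat := (x.1 + x.2)%N.

Lemma measurable_add_nat_bool : measurable_fun [set: nat * bool] add_nat_bool.
Proof.
move=> _ Y _; rewrite setTI.
have -> : add_nat_bool @^-1` Y =
    ([set k | Y k.+1] `*` [set true]) `|` (Y `*` [set false]).
  apply/seteqP; split=> [[k []]|[k b] [] []] /=; rewrite /add_nat_bool/=.
  - by rewrite addn1; left.
  - by rewrite addn0; right.
  - by move=> + ->; rewrite addn1.
  - by move=> + ->; rewrite addn0.
by apply: measurableU; exact: measurableX.
Qed.

HB.instance Definition _ :=
  isMeasurableFun.Build _ _ _ _ add_nat_bool measurable_add_nat_bool.

(* Number of output ones on the all-zeros dataset of size n. *)
Definition zeros_law (R : realType) (n : nat) (p : R) : probability nat R :=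
  binomial_prob n p.

(* Number of output ones on a dataset of size n > 0 with exactly one one: the
   law of the sum of independent Bin(n - 1, p) and Bern(1 - p) variables. *)
Definition one_one_law (R : realType) (n : nat) (p : R) : probability nat R :=
  distribution (binomial_prob n.-1 p \x bernoulli_prob (1 - p)%R)
    add_nat_bool.

Definition likelihood_ratio d (T : measurableType d) (R : realType)
    (Q P : probability T R) : T -> \bar R :=
  'd (charge_of_finite_measure Q) '/d P.

(* Main.v *)
(** With [x = n * delta_n], which tends to 0, Bernoulli's inequality gives
    [P_n {0} >= 1 - x] and [Q_n {1} >= 1 - x]. Hence [P_n] and [Q_n]
    concentrate on two distinct atoms: the event [{1}] makes both distances
    tend to 1, and the identity [L_n(k) * P_n {k} = Q_n {k}], needed only at
    the atoms, controls the likelihood ratio in probability. *)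

Require Import Defs.
From HB Require Import structures.
From mathcomp Require Import all_boot all_order all_algebra.
From mathcomp Require Import all_classical all_reals all_analysis.
From mathcomp Require Import lra.

Set Implicit Arguments.
Unset Strict Implicit.
Unset Printing Implicit Defensive.

Import Order.TTheory GRing.Theory Num.Theory.
Import numFieldNormedType.Exports.

Local Open Scope classical_set_scope.
Local Open Scope ring_scope.

(** * Bounds on the two distances, and the likelihood ratio at atoms *)

Section profile.
Context d (T : measurableType d) (R : realType).
Implicit Types P Q : probability T R.
Local Open Scope ereal_scope.

Lemma probability_EFin P A : measurable A ->
  exists2 p : R, P A = p%:E & (0 <= p <= 1)%R.
Proof.
move=> mA; have PA : P A = (fine (P A))%:E by rewrite fineK ?fin_num_measure.
exists (fine (P A)) => //.
by rewrite -!lee_fin -PA measure_ge0 probability_le1.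
Qed.

Lemma tv_dist_le1 P Q : tv_dist P Q <= 1.
Proof.
apply: ge_ereal_sup => _ [A mA <-].
have [p -> /andP[p0 p1]] := probability_EFin P mA.
have [q -> /andP[q0 q1]] := probability_EFin Q mA.
by rewrite -EFinB abse_EFin lee_fin ler_norml; apply/andP; split; lra.
Qed.

Lemma privacy_profile_le1 P Q eps : privacy_profile Q P eps <= 1.
Proof.
apply: ge_ereal_sup => _ [A mA <-].
have [p -> /andP[p0 p1]] := probability_EFin P mA.
have [q -> /andP[q0 q1]] := probability_EFin Q mA.
rewrite -EFinM -EFinB lee_fin.
have := mulr_ge0 (expR_ge0 eps) p0; lra.
Qed.

Lemma delta_two_le1 P Q eps : delta_two P Q eps <= 1.
Proof. by rewrite /delta_two ge_max !privacy_profile_le1. Qed.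

Lemma tv_dist_ge P Q A : measurable A -> Q A - P A <= tv_dist P Q.
Proof.
move=> mA; apply: le_trans (ereal_sup_ubound _); last by exists A.
have [p -> _] := probability_EFin P mA.
have [q -> _] := probability_EFin Q mA.
by rewrite -!EFinB abse_EFin lee_fin distrC ler_norm.
Qed.

Lemma delta_two_ge P Q eps A : measurable A ->
  Q A - (expR eps)%:E * P A <= delta_two P Q eps.
Proof.
move=> mA; rewrite /delta_two le_max; apply/orP; left.
by apply: ereal_sup_ubound; exists A.
Qed.

Lemma likelihood_ratio_fin_num P Q a : Q `<< P ->
  likelihood_ratio Q P a \is a fin_num.
Proof. by move=> QP; apply: Radon_Nikodym_fin_num. Qed.

(** The Radon-Nikodym derivative is constant on a singleton, so its integral there is a product.
    This pins down its value at every atom of [P], whichever version is chosen. *)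
Lemma likelihood_ratio_set1 P Q a : measurable [set a] -> Q `<< P ->
  likelihood_ratio Q P a * P [set a] = Q [set a].
Proof.
move=> ma QP.
transitivity (\int[P]_(x in [set a]) likelihood_ratio Q P x).
  rewrite -integral_cst//.
  by apply: eq_integral => x /set_mem /= ->.
by rewrite -(Radon_Nikodym_integral (nu := charge_of_finite_measure Q)).
Qed.

End profile.

(** * Laws concentrating on two distinct atoms of a discrete space *)

Section separation.
Context d (T : measurableType d) (R : realType).
Variables (P Q : nat -> probability T R) (a b : T).
Hypotheses (mT : forall A : set T, measurable A) (ab : a != b).
Hypotheses (Pa : P n [set a] @[n --> \oo] --> 1%E)
  (Qb : Q n [set b] @[n --> \oo] --> 1%E).
Local Open Scope ereal_scope.

Lemma cvg_probability_set1_disjoint (S : nat -> probability T R) (x y : T) :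
  x != y -> S n [set x] @[n --> \oo] --> 1 -> S n [set y] @[n --> \oo] --> 0.
Proof.
move=> xy Sx.
have S1 : 1 - S n [set x] @[n --> \oo] --> 0.
  by rewrite -[0](subee (x := 1))//; apply: cvgeB => //; exact: cvg_cst.
apply: (squeeze_cvge _ (cvg_cst 0) S1); apply: nearW => n /=.
rewrite measure_ge0/= -probability_setC//; apply: le_measure; rewrite ?inE//.
by move=> _ -> /= /esym/eqP; rewrite (negbTE xy).
Qed.

Let Pb : P n [set b] @[n --> \oo] --> 0.
Proof. exact: cvg_probability_set1_disjoint ab Pa. Qed.

Let Qa : Q n [set a] @[n --> \oo] --> 0.
Proof. by apply: cvg_probability_set1_disjoint Qb; rewrite eq_sym. Qed.

(** The event [[set b]] suffices as a test: [expR eps] is fixed while the mass of [b] under [P n]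
    vanishes, and the upper bound 1 closes the squeeze. *)
Lemma delta_two_cvg1 eps : delta_two (P n) (Q n) eps @[n --> \oo] --> 1.
Proof.
have QP : Q n [set b] - (expR eps)%:E * P n [set b] @[n --> \oo] --> 1.
  have := cvgeZl (isT : (expR eps)%:E \is a fin_num) Pb.
  by rewrite -[1 in X in _ -> X]sube0 mule0; apply: cvgeB.
apply: (squeeze_cvge _ QP (cvg_cst 1)); apply: nearW => n /=.
by rewrite delta_two_ge// delta_two_le1.
Qed.

Lemma tv_dist_cvg1 : tv_dist (P n) (Q n) @[n --> \oo] --> 1.
Proof.
have QP : Q n [set b] - P n [set b] @[n --> \oo] --> 1.
  by rewrite -[1]sube0; apply: cvgeB.
apply: (squeeze_cvge _ QP (cvg_cst 1)); apply: nearW => n /=.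
by rewrite tv_dist_ge// tv_dist_le1.
Qed.

Hypothesis QP : \forall n \near \oo, Q n `<< P n.

Let L n := likelihood_ratio (Q n) (P n).

(** For large [n] the ratio at [a] is below [eta], so the bad event misses [a] and has mass at most
    [1 - P n [set a]]. *)
Lemma likelihood_ratio_cvg0_in_prob : cvg_in_prob P L 0.
Proof.
move=> eta eta0.
have P1 : 1 - P n [set a] @[n --> \oo] --> 0.
  by rewrite -[0](subee (x := 1))//; apply: cvgeB => //; exact: cvg_cst.
apply: (squeeze_cvge _ (cvg_cst 0) P1); near=> n => /=.
rewrite measure_ge0/= -probability_setC//; apply: le_measure; rewrite ?inE//.
move=> x /= + xa; apply/negP; rewrite xa -leNgt sube0.
have dom : Q n `<< P n by near: n.
have := likelihood_ratio_set1 (mT [set a]) dom; rewrite /L.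
rewrite -(fineK (likelihood_ratio_fin_num a dom)).
(* With [p > 1/2] and [q < eta / 2], the identity [l * p = q] forces [l < eta]. *)
have : (2^-1 < fine (P n [set a]))%R.
  by near: n; apply: (cvgr_gt _ (fine_cvg Pa)); lra.
have : (fine (Q n [set a]) < eta / 2)%R.
  by near: n; apply: (cvgr_lt _ (fine_cvg Qa)); lra.
have [p -> _] := probability_EFin (P n) (mT [set a]).
have [q -> /andP[q0 _]] := probability_EFin (Q n) (mT [set a]).
move: (fine (likelihood_ratio _ _ _)) => l /= qe p2 [lp].
by rewrite lee_fin ler_norml; apply/andP; split; nra.
Unshelve. all: by end_near. Qed.

Lemma likelihood_ratio_cvgy_in_prob : cvgy_in_prob Q L.
Proof.
move=> M.
apply: (squeeze_cvge _ Qb (cvg_cst 1)); near=> n => /=.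
rewrite probability_le1// andbT; apply: le_measure; rewrite ?inE//.
move=> _ /= ->.
have dom : Q n `<< P n by near: n.
have := likelihood_ratio_set1 (mT [set b]) dom; rewrite /L.
rewrite -(fineK (likelihood_ratio_fin_num b dom)).
have : (2^-1 < fine (Q n [set b]))%R.
  by near: n; apply: (cvgr_gt _ (fine_cvg Qb)); lra.
(* If [l <= M], then [q = l * p <= p * (|M| + 1) < 1/2], against [q > 1/2]. Adding 1 keeps the
   threshold meaningful at [M = 0]. *)
have : (fine (P n [set b]) < (2 * (`|M| + 1))^-1)%R.
  near: n; apply: (cvgr_lt _ (fine_cvg Pb)).
  by rewrite invr_gt0 mulr_gt0// ltr_wpDl.
have [p -> /andP[p0 _]] := probability_EFin (P n) (mT [set b]).
have [q -> _] := probability_EFin (Q n) (mT [set b]).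
move: (fine (likelihood_ratio _ _ _)) => l /=.
have M0 := normr_ge0 M; have ltM := ler_norm M.
rewrite -[X in (_ < X)%R]mul1r ltr_pdivlMr ?mulr_gt0 ?ltr_wpDl// => pM q2 [lp].
by rewrite lte_fin ltNge; apply/negP => lM; nra.
Unshelve. all: by end_near. Qed.

End separation.

(** * Atoms of the two laws, and absolute continuity *)

Lemma bernoulli_ineq (R : realDomainType) (p : R) n : 0 <= p <= 1 ->
  1 - n%:R * p <= (1 - p) ^+ n.
Proof.
move=> /andP[p0 p1]; elim: n => [|n IHn]; first by rewrite expr0 mul0r subr0.
rewrite exprS; apply: le_trans (ler_wpM2l _ IHn); last by rewrite subr_ge0.
(* The term dropped from [(1 - p) * (1 - n * p)] is [n * p ^ 2]. *)
have := mulr_ge0 (ler0n R n) (mulr_ge0 p0 p0); rewrite -natr1.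
by set m := n%:R; nra.
Qed.

Section laws.
Context (R : realType).
Variable p : R.
Implicit Types n k : nat.
Hypothesis p01 : 0 < p < 1.

Let p01W : 0 <= p <= 1.
Proof. by case/andP: p01 => /ltW -> /ltW ->. Qed.

Lemma zeros_law_set1 n k : zeros_law n p [set k] = (binomial_pmf n p k)%:E.
Proof.
rewrite /zeros_law /= /binomial_prob p01W esum_set1//.
by rewrite lee_fin binomial_pmf_ge0.
Qed.

Lemma zeros_law_set0 n : zeros_law n p [set 0%N] = ((1 - p) ^+ n)%:E.
Proof.
by rewrite zeros_law_set1 /binomial_pmf expr0 mul1r subn0 bin0 mulr1n.
Qed.

Lemma zeros_law_set0_ge n :
  ((1 - n%:R * p)%:E <= zeros_law n p [set 0%N])%E.
Proof. by rewrite zeros_law_set0 lee_fin bernoulli_ineq. Qed.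

(** One way to get a single output one is that no bit flips; by independence this has probability
    [(1 - p) ^ (n - 1) * (1 - p)]. *)
Lemma one_one_law_set1_ge n : (0 < n)%N ->
  ((1 - n%:R * p)%:E <= one_one_law n p [set 1%N])%E.
Proof.
move=> n0; apply: (@le_trans _ _
    ((binomial_prob n.-1 p \x bernoulli_prob (1 - p))%E
      ([set 0%N] `*` [set true]))); last first.
  apply: le_measure; rewrite ?inE; first exact: measurableX.
    by rewrite -[X in measurable X]setTI; exact: measurable_add_nat_bool.
  by move=> [k b] /= [-> ->].
have bern1 : bernoulli_prob (1 - p) [set true] = (1 - p)%:E.
  rewrite bernoulli_probE; last first.
    by case/andP: p01W => p0 p1; rewrite subr_ge0 p1 lerBlDr lerDl.
  by rewrite !diracE mem_set// memNset// mule1 mule0 adde0.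
rewrite product_measure1E// [X in (_ <= X * _)%E](zeros_law_set0 n.-1).
rewrite [X in (_ <= _ * X)%E]bern1.
rewrite -EFinM -exprSr prednK// lee_fin; exact: bernoulli_ineq.
Qed.

(** Since [0 < p < 1], [zeros_law] charges every [k <= n], so its null sets lie above [n], which the
    sum of [n] bits never exceeds. *)
Lemma one_one_law_dominates n : (0 < n)%N -> one_one_law n p `<< zeros_law n p.
Proof.
move=> n0; apply/null_content_dominatesP => A mA PA0.
have supp k : A k -> (n < k)%N.
  move=> Ak; rewrite ltnNge; apply/negP => kn.
  have : (zeros_law n p [set k] <= zeros_law n p A)%E.
    by apply: le_measure; rewrite ?inE// => _ ->.
  rewrite PA0 zeros_law_set1 lee_fin leNgt /binomial_pmf.
  case/andP: p01 => p0 p1.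
  by rewrite pmulrn_lgt0 ?bin_gt0// mulr_gt0 ?exprn_gt0 ?subr_gt0.
set mu := (binomial_prob n.-1 p \x bernoulli_prob (1 - p))%E.
have le_mu : (mu (add_nat_bool @^-1` A) <=
    mu ([set k | (n <= k)%N] `*` [set: bool]))%E.
  apply: le_measure; rewrite ?inE.
    by rewrite -[X in measurable X]setTI; exact: measurable_add_nat_bool.
  exact: measurableX.
  move=> [k b] /= /supp; rewrite /add_nat_bool/= => nk; split => //=.
  by case: b nk => /=; rewrite ?addn1 ?addn0 => // /ltnW.
(* A sum above [n] needs a binomial part of at least [n], one more than its maximum [n.-1]. *)
have bin0 : binomial_prob n.-1 p [set k | (n <= k)%N] = 0%E.
  rewrite /binomial_prob p01W esum1// => k /= nk.
  by rewrite /binomial_pmf bin_small// prednK.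
apply/eqP; rewrite eq_le measure_ge0 andbT; apply: (le_trans le_mu).
by rewrite /mu product_measure1E// [X in (X * _)%E]bin0 mul0e.
Qed.

End laws.

(** * The flip probability and the regime of the theorem *)

Section flip_prob.
Context (R : realType).
Implicit Types e : R.

Lemma flip_prob01 e : 0 < flip_prob e < 1.
Proof.
have := expR_gt0 e; rewrite /flip_prob => e0.
by rewrite invr_gt0 addr_gt0//= invf_lt1 ?addr_gt0// ltrDl.
Qed.

(** The product is at most [n / expR (eps0 n)], the inverse of the diverging sequence. *)
Lemma flip_prob_cvg0 (eps0 : nat -> R) :
  expR (eps0 n) / n%:R @[n --> \oo] --> +oo ->
  n%:R * flip_prob (eps0 n) @[n --> \oo] --> 0.
Proof.
move=> a_infty.
have a_gt0 : \forall n \near \oo, 0 < expR (eps0 n) / n%:R.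
  by exists 1%N => // n /= n0; rewrite divr_gt0 ?expR_gt0// ltr0n.
have /(gtr0_cvgV0 a_gt0) a0 := a_infty.
apply: (squeeze_cvgr _ (cvg_cst 0) a0); apply: nearW => n /=.
have := expR_gt0 (eps0 n); rewrite /flip_prob invf_div => e0.
rewrite mulr_ge0 ?invr_ge0 ?addr_ge0 ?expR_ge0//=.
by rewrite ler_wpM2l// lef_pV2 ?posrE ?addr_gt0// lerDr.
Qed.

End flip_prob.

Theorem proposition6p3 (R : realType) (eps0 : nat -> R)
    (eps0_gt0 : forall n, (0 < n)%N -> 0 < eps0 n)
    (a_infty : expR (eps0 n) / n%:R @[n --> \oo] --> +oo) :
  let P n := zeros_law n (flip_prob (eps0 n)) in
  let Q n := one_one_law n (flip_prob (eps0 n)) in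
  let L n := likelihood_ratio (Q n) (P n) in
  [/\ tv_dist (P n) (Q n) @[n --> \oo] --> 1%E,
      forall eps : R, 0 <= eps ->
        delta_two (P n) (Q n) eps @[n --> \oo] --> 1%E,
      cvg_in_prob P L 0 &
      cvgy_in_prob Q L].
Proof.
move=> P Q L.
have x1 : (1 - n%:R * flip_prob (eps0 n))%:E @[n --> \oo] --> (1 : \bar R)%E.
  apply: cvg_EFin; first exact: nearW.
  rewrite -[X in _ --> X]subr0.
  by apply: cvgB; [exact: cvg_cst|exact: flip_prob_cvg0].
have P0 : P n [set 0%N] @[n --> \oo] --> 1%E.
  apply: (squeeze_cvge _ x1 (cvg_cst 1%E)); apply: nearW => n /=.
  apply/andP; split; last exact: (probability_le1 (P n)).
  by rewrite zeros_law_set0_ge ?flip_prob01.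
have Q1 : Q n [set 1%N] @[n --> \oo] --> 1%E.
  apply: (squeeze_cvge _ x1 (cvg_cst 1%E)); near=> n => /=.
  apply/andP; split; last exact: (probability_le1 (Q n)).
  rewrite one_one_law_set1_ge ?flip_prob01//.
  by near: n; exists 1%N.
(* At [n = 0] domination fails: [0.-1 = 0] leaves a lone Bernoulli bit in [Q 0], which charges 1,
   while [P 0] is the point mass at 0. *)
have QP : \forall n \near \oo, Q n `<< P n.
  exists 1%N => // n /= n0.
  by apply: one_one_law_dominates; rewrite ?flip_prob01.
have mT (A : set nat) : measurable A by [].
have n01 : 0%N != 1%N by [].
split.
- exact: tv_dist_cvg1 mT n01 P0 Q1.
- by move=> eps _; exact: delta_two_cvg1 mT n01 P0 Q1 eps.
- exact: likelihood_ratio_cvg0_in_prob mT n01 P0 Q1 QP.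
- exact: likelihood_ratio_cvgy_in_prob mT n01 P0 Q1 QP.
Unshelve. all: by end_near. Qed.
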